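(* Let $K$ be a field of characteristic $2$, let $q = 2^{\alpha}$ with $\alpha$ a positive integer, and let $n$ be an integer with $q/2 < n \leq q$. Then $$S^2(W_n) \cong S^2(W_{q-n}) \oplus W_q^{n-q/2} \oplus W_1^{n-q/2}$$ as $\mathfrak{w}_q$-modules.
   Context: $\mathfrak{w}_q$ is the abelian $2$-Lie algebra (restricted Lie algebra) over $K$ generated by a single nilpotent element $e$ with $e^{[q]} = 0$, so $\mathfrak{w}_q = \bigoplus_{0 \leq i < \alpha} \langle e^{[2^i]} \rangle$ as a vector space. In a restricted module $e^{[2^i]}$ acts as the $2^i$-th power of the action of $e$, so a restricted $\mathfrak{w}_q$-module is the same as a $K$-vector space with an endomorphism $e$ such that $e^q = 0$. The indecomposable restricted $\mathfrak{w}_q$-modules are $W_1, \ldots, W_q$, where $\dim W_i = i$ and $e$ acts on $W_i$ as a single $i \times i$ nilpotent Jordan block. Set $W_0 = 0$. For a module $W$, $W^0 = 0$ and $W^d$ is the direct sum of $d$ copies of $W$ for $d>0$. The symmetric square $S^2(V)$ (the quotient of $V \otimes V$ by the span of the elements $v \otimes w - w \otimes v$) carries the Lie algebra action $e \cdot (vw) = (ev)w + v(ew)$. *)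

(* Defs.v *)
From HB Require Import structures.
From mathcomp Require Import all_boot all_algebra.

Set Implicit Arguments.
Unset Strict Implicit.
Unset Printing Implicit Defensive.

Import GRing.Theory.
Local Open Scope ring_scope.

Section VectorQuotient.
Local Open Scope quotient_scope.
Variables (K : fieldType) (V : vectType K) (U : {vspace V}).

Definition vspace_zmod : zmodClosed V := pred_of_vspace U.

Definition vquot : Type := Quotient.quot vspace_zmod.

HB.instance Definition _ := GRing.Zmodule.copy vquot (Quotient.quot vspace_zmod).

Definition vpi (v : V) : vquot := \pi_(Quotient.quot vspace_zmod) v.
Definition vrepr (x : vquot) : V := repr x.

Lemma vreprK : cancel vrepr vpi. Proof. exact: reprK. Qed.

Lemma vpi_eq v w : (vpi v == vpi w) = (v - w \in U).
Proof. by symmetry; exact: (Quotient.idealrBE vspace_zmod v w). Qed.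

Lemma vpiD v w : vpi (v + w) = vpi v + vpi w.
Proof. exact: (raddfD \pi_(Quotient.quot vspace_zmod)). Qed.

Definition vquot_scale (a : K) (x : vquot) : vquot := vpi (a *: vrepr x).

Lemma vpiZ_subproof a v : vquot_scale a (vpi v) = vpi (a *: v).
Proof.
apply/eqP; rewrite vpi_eq -scalerBr; apply: rpredZ.
by rewrite -vpi_eq vreprK.
Qed.

Fact vquot_scaleA a b x :
  vquot_scale a (vquot_scale b x) = vquot_scale (a * b) x.
Proof. by rewrite -[x]vreprK !vpiZ_subproof scalerA. Qed.
Fact vquot_scale1 : left_id 1 vquot_scale.
Proof. by move=> x; rewrite -[x]vreprK vpiZ_subproof scale1r. Qed.
Fact vquot_scaleDr : right_distributive vquot_scale +%R.
Proof.
move=> a x y; rewrite -[x]vreprK -[y]vreprK -vpiD !vpiZ_subproof.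
by rewrite scalerDr vpiD.
Qed.
Fact vquot_scaleDl x : {morph vquot_scale^~ x : a b / a + b}.
Proof.
by move=> a b /=; rewrite -[x]vreprK !vpiZ_subproof scalerDl vpiD.
Qed.

HB.instance Definition _ := GRing.Zmodule_isLmodule.Build K vquot
  vquot_scaleA vquot_scale1 vquot_scaleDr vquot_scaleDl.

Fact vpi_is_linear : linear vpi.
Proof. by move=> a v w; rewrite vpiD -vpiZ_subproof. Qed.
HB.instance Definition _ := GRing.isLinear.Build K V vquot _ vpi vpi_is_linear.

(* Coordinates on V / U are those of the complement U^C, along U. *)
Local Notation proj := (daddv_pi U^C U).

Let capC : (U^C :&: U = 0)%VS. Proof. by rewrite capvC capv_compl. Qed.

Let proj_pi v : v - proj v \in U.
Proof.
have vUC : v \in (U^C + U)%VS by rewrite addvC addv_complf memvf.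
by rewrite -{1}(daddv_pi_add capC vUC) addrAC subrr add0r memv_pi.
Qed.

Let proj_U v : v \in U -> proj v = 0.
Proof.
move=> vU; apply/eqP; rewrite -memv0 -capC memv_cap memv_pi /=.
by rewrite -[proj v](subKr v) rpredB // proj_pi.
Qed.

Let proj_repr v : proj (vrepr (vpi v)) = proj v.
Proof.
apply/eqP; rewrite -subr_eq0 -linearB /= proj_U //.
by rewrite -vpi_eq vreprK.
Qed.

Fact vquot_vect_iso : Vector.axiom (\dim U^C) vquot.
Proof.
pose f (x : vquot) := \row_i coord (vbasis U^C) i (proj (vrepr x)).
exists f.
  move=> a x y; rewrite -[x]vreprK -[y]vreprK -linearP.
  by apply/rowP => i; rewrite !mxE !proj_repr !linearP.
exists (fun r : 'rV_(\dim U^C) => vpi (\sum_i r 0 i *: (vbasis U^C)`_i)).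
  move=> x; rewrite -[in RHS](vreprK x); apply/eqP; rewrite vpi_eq -opprB rpredN.
  under eq_bigr do rewrite mxE.
  by rewrite -coord_vbasis ?memv_pi // proj_pi.
move=> r; apply/rowP => i; rewrite mxE proj_repr.
rewrite daddv_pi_id //; last first.
  apply: rpred_sum => j _; apply/rpredZ/vbasis_mem.
  by rewrite mem_nth // size_tuple.
by rewrite coord_sum_free // (basis_free (vbasisP _)).
Qed.
HB.instance Definition _ := Lmodule_hasFinDim.Build K vquot vquot_vect_iso.

End VectorQuotient.

Definition bilin (K : fieldType) (V Z : lmodType K) (g : V -> V -> Z) :=
  (forall v, linear (g v)) /\ (forall w, linear (g^~ w)).

Section SymmetricSquare.
Variables (K : fieldType) (V : vectType K).
Local Notation b := (vbasis (fullv : {vspace V})).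
Local Notation d := (\dim (fullv : {vspace V})).

(* V (x) V, with T standing for \sum_(i, j) T i j *: (b`_i (x) b`_j). *)
Definition tens : Type := 'M[K]_d.
HB.instance Definition _ := Vector.on tens.

Definition tmul (v w : V) : tens := \matrix_(i, j) (coord b i v * coord b j w).

Lemma tmul_bilin : bilin tmul.
Proof.
split=> [v a w w' | w a v v']; apply/matrixP => i j; rewrite !mxE linearP /=.
  by rewrite mulrDr mulrCA.
by rewrite mulrDl mulrA.
Qed.

Definition tlift (Z : lmodType K) (g : V -> V -> Z) (T : tens) : Z :=
  \sum_i \sum_j T i j *: g b`_i b`_j.

Lemma tlift_is_linear (Z : lmodType K) (g : V -> V -> Z) : linear (tlift g).
Proof.
move=> a S T; rewrite /tlift scaler_sumr -big_split /=; apply: eq_bigr => i _.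
rewrite scaler_sumr -big_split /=; apply: eq_bigr => j _.
by rewrite !mxE scalerDl scalerA.
Qed.
HB.instance Definition _ (Z : lmodType K) (g : V -> V -> Z) :=
  GRing.isLinear.Build K tens Z _ (tlift g) (@tlift_is_linear Z g).

Lemma bilin_coord (Z : lmodType K) (g : V -> V -> Z) v w : bilin g ->
  g v w = \sum_i \sum_j (coord b i v * coord b j w) *: g b`_i b`_j.
Proof.
case=> gr gl.
pose GL w := GRing.isLinear.Build _ _ _ _ _ (gl w).
pose gL w : {linear V -> Z} := HB.pack (g^~ w) (GL w).
pose GR v := GRing.isLinear.Build _ _ _ _ _ (gr v).
pose gR v : {linear V -> Z} := HB.pack (g v) (GR v).
rewrite {1}(coord_vbasis (memvf v)) -[LHS]/(gL w _) linear_sum.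
apply: eq_bigr => i _; rewrite linearZ /=.
rewrite {1}(coord_vbasis (memvf w)) -[g _ _]/(gR b`_i _) linear_sum scaler_sumr.
by apply: eq_bigr => j _; rewrite linearZ /= scalerA.
Qed.

Lemma tliftE (Z : lmodType K) (g : V -> V -> Z) v w : bilin g -> tlift g (tmul v w) = g v w.
Proof.
move=> g_bilin; rewrite (bilin_coord v w g_bilin).
by apply: eq_bigr => i _; apply: eq_bigr => j _; rewrite mxE.
Qed.

Lemma tens_sum (T : tens) : T = tlift tmul T.
Proof.
apply/matrixP => k l; rewrite /tlift !summxE (bigD1 k) //= summxE (bigD1 l) //=.
have free_b := basis_free (vbasisP (fullv : {vspace V})).
rewrite !mxE !coord_free // !eqxx !mulr1 !big1 ?addr0 //.
  move=> i ne_ik; rewrite summxE big1 // => j _.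
  by rewrite !mxE !coord_free // (negPf ne_ik) mul0r mulr0.
move=> j ne_jl.
by rewrite !mxE !coord_free // (negPf ne_jl) !mulr0.
Qed.

(* By bilinearity, pairs of basis vectors suffice to span all the              *)
(* v (x) w - w (x) v; see sym_relP.                                            *)
Definition sym_rel : {vspace tens} :=
  <<[seq tmul b`_ij.1 b`_ij.2 - tmul b`_ij.2 b`_ij.1 | ij : 'I_d * 'I_d]>>%VS.

Lemma sym_rel_mem v w : tmul v w - tmul w v \in sym_rel.
Proof.
have c_bilin : bilin (fun v w => tmul v w - tmul w v).
  have [tr tl] := tmul_bilin.
  by split=> [x | x] a y z /=; rewrite tr tl scalerBr opprD addrACA.
rewrite (bilin_coord v w c_bilin).
apply: rpred_sum => i _; apply: rpred_sum => j _; apply: rpredZ.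
by apply: memv_span; apply/imageP; exists (i, j).
Qed.

Lemma sym_relP (T : tens) :
  reflect (exists s : seq (V * V),
             T \in <<[seq tmul vw.1 vw.2 - tmul vw.2 vw.1 | vw <- s]>>%VS)
          (T \in sym_rel).
Proof.
apply: (iffP idP) => [Ts | [s]]; last first.
  apply: subvP; apply/span_subvP => _ /mapP[[v w] _ ->].
  exact: sym_rel_mem.
exists [seq (b`_ij.1, b`_ij.2) | ij : 'I_d * 'I_d].
by rewrite -map_comp.
Qed.

Definition sym2 : Type := vquot sym_rel.
HB.instance Definition _ := Vector.on sym2.

Definition smul (v w : V) : sym2 := vpi sym_rel (tmul v w).

Lemma smulC v w : smul v w = smul w v.
Proof. by apply/eqP; rewrite vpi_eq sym_rel_mem. Qed.

Lemma smul_bilin : bilin smul.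
Proof.
have [tr tl] := tmul_bilin.
by split=> [v a w w' | w a v v']; rewrite /smul ?tr ?tl linearP.
Qed.

Definition slift (Z : lmodType K) (g : V -> V -> Z) (x : sym2) : Z :=
  tlift g (vrepr x).

Lemma slift_pi (Z : lmodType K) (g : V -> V -> Z) T : bilin g -> commutative g ->
  slift g (vpi sym_rel T) = tlift g T.
Proof.
move=> g_bilin gC; apply/eqP; rewrite -subr_eq0 -linearB /=.
have: vrepr (vpi sym_rel T) - T \in sym_rel by rewrite -vpi_eq vreprK.
case/sym_relP=> s; set X := map _ _ => TX.
rewrite (coord_span (X := in_tuple X) TX) linear_sum big1 // => i _.
have lt_is : (i < size s)%N.
  by rewrite -(size_map (fun vw => tmul vw.1 vw.2 - tmul vw.2 vw.1)).
rewrite linearZ /= (nth_map (0, 0)) // [tlift _ _]linearB /= !tliftE //.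
by rewrite gC subrr scaler0.
Qed.

Lemma sliftE (Z : lmodType K) (g : V -> V -> Z) v w : bilin g -> commutative g ->
  slift g (smul v w) = g v w.
Proof. by move=> g_bilin gC; rewrite slift_pi // tliftE. Qed.

Lemma slift_linear (Z : lmodType K) (g : V -> V -> Z) : bilin g -> commutative g ->
  linear (slift g).
Proof.
move=> g_bilin gC a x y; rewrite -[x]vreprK -[y]vreprK -linearP /=.
by rewrite !slift_pi // linearP.
Qed.

Lemma sym2_ext (Z : lmodType K) (f h : sym2 -> Z) : linear f -> linear h ->
  (forall v w, f (smul v w) = h (smul v w)) -> f =1 h.
Proof.
move=> f_lin h_lin fh x.
pose F : {linear sym2 -> Z} := HB.pack f (GRing.isLinear.Build _ _ _ _ _ f_lin).
pose H : {linear sym2 -> Z} := HB.pack h (GRing.isLinear.Build _ _ _ _ _ h_lin).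
rewrite -[f x]/(F x) -[h x]/(H x) -[x]vreprK (tens_sum (vrepr x)) /tlift.
rewrite !linear_sum; apply: eq_bigr => i _.
by rewrite !linear_sum; apply: eq_bigr => j _; rewrite !linearZ /= fh.
Qed.

End SymmetricSquare.

(* 2-Lie algebras, lsq x being x^[2]; this is the notion of a restricted Lie   *)
(* algebra when K has characteristic 2, the only case in which it is used.     *)
Record lie2 (K : fieldType) := Lie2 {
  lie2_sort :> lmodType K;
  lbr : lie2_sort -> lie2_sort -> lie2_sort;
  lsq : lie2_sort -> lie2_sort;
  lbr_bilin : bilin lbr;
  lbrxx : forall x, lbr x x = 0;
  lbr_jacobi : forall x y z,
    lbr x (lbr y z) + lbr y (lbr z x) + lbr z (lbr x y) = 0;
  lsqZ : forall a x, lsq (a *: x) = a ^+ 2 *: lsq x;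
  lsqD : forall x y, lsq (x + y) = lsq x + lsq y + lbr x y;
  lbr_sq : forall x y, lbr (lsq x) y = lbr x (lbr x y) }.

(* The restricted modules considered are all finite-dimensional. *)
Record rmod (K : fieldType) (g : lie2 K) := RMod {
  rmod_sort :> vectType K;
  act : g -> rmod_sort -> rmod_sort;
  act_linl : forall v, linear (act^~ v);
  act_linr : forall x, linear (act x);
  act_br : forall x y v, act (lbr x y) v = act x (act y v) - act y (act x v);
  act_sq : forall x v, act (lsq x) v = act x (act x v) }.

Section Modules.
Variables (K : fieldType) (g : lie2 K).

Definition rmod_iso (V W : rmod g) : Prop :=
  exists f : {linear V -> W},
    bijective f /\ forall (x : g) (v : V), f (act x v) = act x (f v).

Section DirectSum.
Variables V W : rmod g.
Let S : vectType K := (V * W)%type.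
Definition dsum_act (x : g) (v : S) : S := (act x v.1, act x v.2).
Fact dsum_linl v : linear (dsum_act^~ v).
Proof. by move=> a x y; rewrite /dsum_act !act_linl. Qed.
Fact dsum_linr x : linear (dsum_act x).
Proof. by move=> a v w; rewrite /dsum_act /= !act_linr. Qed.
Fact dsum_br x y v : dsum_act (lbr x y) v =
  dsum_act x (dsum_act y v) - dsum_act y (dsum_act x v).
Proof. by rewrite /dsum_act /= !act_br. Qed.
Fact dsum_sq x v : dsum_act (lsq x) v = dsum_act x (dsum_act x v).
Proof. by rewrite /dsum_act /= !act_sq. Qed.
Definition dsum : rmod g := RMod dsum_linl dsum_linr dsum_br dsum_sq.
End DirectSum.

Section Copies.
Variables (V : rmod g) (m : nat).
Let S : vectType K := {ffun 'I_m -> V}.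
Definition copies_act (x : g) (v : S) : S := [ffun i => act x (v i)].
Fact copies_linl v : linear (copies_act^~ v).
Proof. by move=> a x y; apply/ffunP => i; rewrite !ffunE act_linl. Qed.
Fact copies_linr x : linear (copies_act x).
Proof. by move=> a v w; apply/ffunP => i; rewrite !ffunE act_linr. Qed.
Fact copies_br x y v : copies_act (lbr x y) v =
  copies_act x (copies_act y v) - copies_act y (copies_act x v).
Proof. by apply/ffunP => i; rewrite !ffunE act_br. Qed.
Fact copies_sq x v : copies_act (lsq x) v = copies_act x (copies_act x v).
Proof. by apply/ffunP => i; rewrite !ffunE act_sq. Qed.
Definition copies : rmod g := RMod copies_linl copies_linr copies_br copies_sq.
End Copies.

Section Sym2Module.
Hypothesis charK : 2%N \in [pchar K].
Variable V : rmod g.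

Definition leibniz (x : g) (v w : V) : sym2 V :=
  smul (act x v) w + smul v (act x w).
Definition sym2_act (x : g) : sym2 V -> sym2 V := slift (leibniz x).

Lemma leibniz_bilin x : bilin (leibniz x).
Proof.
have [sr sl] := smul_bilin V.
by split=> v a w w'; rewrite /leibniz !act_linr !(sr, sl) scalerDr addrACA.
Qed.

Lemma leibnizC x : commutative (leibniz x).
Proof. by move=> v w; rewrite /leibniz addrC; congr (_ + _); apply: smulC. Qed.

Lemma sym2_actE x v w :
  sym2_act x (smul v w) = smul (act x v) w + smul v (act x w).
Proof. by rewrite /sym2_act sliftE //; [apply: leibniz_bilin|apply: leibnizC]. Qed.

Fact sym2_linr x : linear (sym2_act x).
Proof. by apply: slift_linear; [apply: leibniz_bilin | apply: leibnizC]. Qed.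

Let actD x s t : sym2_act x (s + t) = sym2_act x s + sym2_act x t.
Proof. by have := sym2_linr x 1 s t; rewrite !scale1r. Qed.

Let smulDl (u v w : V) : smul (u + v) w = smul u w + smul v w.
Proof. by have := (smul_bilin V).2 w 1 u v; rewrite !scale1r. Qed.
Let smulDr (u v w : V) : smul w (u + v) = smul w u + smul w v.
Proof. by have := (smul_bilin V).1 w 1 u v; rewrite !scale1r. Qed.
Let smulNl (u w : V) : smul (- u) w = - smul u w.
Proof.
have := (smul_bilin V).2 w (-1) u 0; rewrite addr0 !scaleN1r => ->.
have := (smul_bilin V).2 w (-1) 0 0.
by rewrite scaler0 addr0 scaleN1r addNr => ->; rewrite addr0.
Qed.
Let smulNr (u w : V) : smul w (- u) = - smul w u.
Proof. by rewrite smulC smulNl smulC. Qed.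

Fact sym2_linl s : linear (sym2_act^~ s).
Proof.
move=> a x y /=.
apply: (sym2_ext (f := sym2_act (a *: x + y))
                 (h := fun s => a *: sym2_act x s + sym2_act y s)).
- exact: sym2_linr.
- move=> c u v; rewrite !sym2_linr !scalerDr !scalerA [a * c]mulrC.
  by rewrite addrACA.
move=> v w; rewrite !sym2_actE !act_linl.
by rewrite (smul_bilin V).1 (smul_bilin V).2 scalerDr addrACA.
Qed.

Fact sym2_br x y s : sym2_act (lbr x y) s =
  sym2_act x (sym2_act y s) - sym2_act y (sym2_act x s).
Proof.
apply: (sym2_ext (f := sym2_act (lbr x y))
   (h := fun s => sym2_act x (sym2_act y s) - sym2_act y (sym2_act x s))).
- exact: sym2_linr.
- by move=> c u v; rewrite !sym2_linr scalerBr opprD addrACA.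
move=> v w; rewrite !sym2_actE !actD !sym2_actE !act_br.
rewrite smulDl smulDr smulNl smulNr.
have cancel (A : zmodType) (p p' q q' r r' : A) :
    p - p' + (q - q') = p + r' + (r + q) - (p' + r + (r' + q')).
  rewrite addrACA -opprD [r + q]addrC [r' + q']addrC.
  rewrite [p + r' + _]addrACA [p' + r + _]addrACA [r + r']addrC.
  by rewrite [p' + q' + _]addrC [in RHS]opprD [RHS]addrA addrK.
exact: cancel.
Qed.

Fact sym2_sq x s : sym2_act (lsq x) s = sym2_act x (sym2_act x s).
Proof.
apply: (sym2_ext (f := sym2_act (lsq x))
                 (h := fun s => sym2_act x (sym2_act x s))).
- exact: sym2_linr.
- by move=> c u v; rewrite !sym2_linr.
move=> v w; rewrite !sym2_actE !actD !sym2_actE !act_sq.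
have cancel (A : lmodType K) (a b d : A) : a + d = a + b + (b + d).
  rewrite -addrA [b + (b + d)]addrA -mulr2n -scaler_nat (pcharf0 charK).
  by rewrite scale0r add0r.
exact: cancel.
Qed.

Definition symsq : rmod g := RMod sym2_linl sym2_linr sym2_br sym2_sq.
End Sym2Module.
End Modules.

Section NilCyclic.
Variables (K : fieldType) (charK : 2%N \in [pchar K]) (alpha : nat).

Let addKK (V : lmodType K) (v : V) : v + v = 0.
Proof. by rewrite -mulr2n -scaler_nat (pcharf0 charK) scale0r. Qed.

Let sqrD (a b : K) : (a + b) ^+ 2 = a ^+ 2 + b ^+ 2.
Proof. by rewrite sqrrD -mulr_natl (pcharf0 charK) mul0r addr0. Qed.

(* e^[2^k], which is 0 as soon as k >= alpha. *)
Definition wq_e (k : nat) : 'rV[K]_alpha := \row_i (i == k :> nat)%:R.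

(* The bracket being 0, the 2-map is additive and semilinear, hence determined *)
(* by its values on the basis e^[2^i], i < alpha.                              *)
Definition wq_br (x y : 'rV[K]_alpha) : 'rV[K]_alpha := 0.
Definition wq_sq (x : 'rV[K]_alpha) : 'rV[K]_alpha :=
  \sum_(i < alpha) x 0 i ^+ 2 *: wq_e i.+1.

Fact wq_bilin : bilin wq_br.
Proof. by split=> x a y z; rewrite /wq_br scaler0 addr0. Qed.
Fact wq_jacobi x y z :
  wq_br x (wq_br y z) + wq_br y (wq_br z x) + wq_br z (wq_br x y) = 0.
Proof. by rewrite /wq_br !addr0. Qed.
Fact wq_sqZ a x : wq_sq (a *: x) = a ^+ 2 *: wq_sq x.
Proof.
rewrite /wq_sq scaler_sumr; apply: eq_bigr => i _.
by rewrite mxE exprMn scalerA.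
Qed.
Fact wq_sqD x y : wq_sq (x + y) = wq_sq x + wq_sq y + wq_br x y.
Proof.
rewrite addr0 /wq_sq -big_split; apply: eq_bigr => i _ /=.
by rewrite mxE sqrD scalerDl.
Qed.

Definition wq : lie2 K :=
  @Lie2 K 'rV[K]_alpha wq_br wq_sq wq_bilin (fun=> erefl) wq_jacobi
    wq_sqZ wq_sqD (fun _ _ => erefl).

Lemma wq_sq_e k : wq_sq (wq_e k) = wq_e k.+1.
Proof.
rewrite /wq_sq; case: (ltnP k alpha) => [lt_k | le_k].
  rewrite (bigD1 (Ordinal lt_k)) //= mxE eqxx expr1n scale1r big1 ?addr0 // => i.
  by rewrite -val_eqE /= => ne_ik; rewrite mxE (negPf ne_ik) expr0n scale0r.
rewrite big1 => [|i _].
  by apply/rowP => i; rewrite !mxE ltn_eqF // (leq_trans (ltn_ord i)) ?leqW.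
by rewrite mxE ltn_eqF ?expr0n ?scale0r // (leq_trans (ltn_ord i)).
Qed.

Lemma wq_gen k : iter k (@lsq K wq) (wq_e 0) = wq_e k.
Proof. by elim: k => //= k ->; rewrite wq_sq_e. Qed.

Lemma wq_nil : iter alpha (@lsq K wq) (wq_e 0) = 0.
Proof. by rewrite wq_gen; apply/rowP => i; rewrite !mxE ltn_eqF. Qed.

Lemma wq_span (x : 'rV[K]_alpha) : x = \sum_(i < alpha) x 0 i *: wq_e i.
Proof.
rewrite [LHS]row_sum_delta; apply: eq_bigr => i _; congr (_ *: _).
by apply/rowP => j; rewrite !mxE.
Qed.

(* A single n x n Jordan block, acting on row vectors by v |-> v *m jordan n.  *)
Definition jordan (n : nat) : 'M[K]_n := \matrix_(i, j) (i.+1 == j :> nat)%:R.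

Lemma jordanX n k : jordan n ^+ k = \matrix_(i, j) (i + k == j :> nat)%N%:R.
Proof.
elim: k => [|k IHk]; first by apply/matrixP => i j; rewrite expr0 !mxE addn0.
apply/matrixP => i j; rewrite exprSr IHk !mxE.
case: (ltnP (i + k) n) => [lt_n | le_n].
  rewrite (bigD1 (Ordinal lt_n)) //= !mxE eqxx mul1r addnS big1 ?addr0 // => l.
  by rewrite -val_eqE /= eq_sym => ne; rewrite !mxE (negPf ne) mul0r.
rewrite big1 => [|l _].
  by rewrite addnS gtn_eqF // (leq_trans (ltn_ord j)) // leqW.
by rewrite !mxE gtn_eqF ?mul0r // (leq_trans (ltn_ord l)).
Qed.

Lemma jordan_nil n k : (n <= k)%N -> jordan n ^+ k = 0.
Proof.
move=> le_nk; apply/matrixP => i j; rewrite jordanX !mxE gtn_eqF //.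
by rewrite (leq_trans (ltn_ord j)) // (leq_trans le_nk) // leq_addl.
Qed.

Section JordanModule.
Variables (n : nat) (le_nq : (n <= 2 ^ alpha)%N).

Definition W_mx (x : wq) : 'M[K]_n :=
  \sum_(i < alpha) (x : 'rV[K]_alpha) 0 i *: jordan n ^+ (2 ^ i).
Definition W_act (x : wq) (v : 'rV[K]_n) : 'rV[K]_n := v *m W_mx x.

Lemma W_mx_e k : W_mx (wq_e k) = jordan n ^+ (2 ^ k).
Proof.
rewrite /W_mx; case: (ltnP k alpha) => [lt_k | le_k].
  rewrite (bigD1 (Ordinal lt_k)) //= mxE eqxx scale1r big1 ?addr0 // => i.
  by rewrite -val_eqE /= => ne_ik; rewrite mxE (negPf ne_ik) scale0r.
rewrite big1 => [|i _]; last first.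
  by rewrite mxE ltn_eqF ?scale0r // (leq_trans (ltn_ord i)).
by rewrite jordan_nil // (leq_trans le_nq) // leq_exp2l.
Qed.

Lemma W_mx_lin : linear W_mx.
Proof.
move=> a x y; rewrite /W_mx scaler_sumr -big_split; apply: eq_bigr => i _ /=.
by rewrite !mxE scalerDl scalerA.
Qed.
HB.instance Definition _ := GRing.isLinear.Build K _ _ _ W_mx W_mx_lin.

Lemma W_mxC x y : W_mx x *m W_mx y = W_mx y *m W_mx x.
Proof.
rewrite /W_mx !mulmx_suml.
under eq_bigr do rewrite mulmx_sumr.
rewrite exchange_big /=; apply: eq_bigr => j _; rewrite mulmx_sumr.
apply: eq_bigr => i _; rewrite -!scalemxAl -!scalemxAr !scalerA mulrC.
by rewrite -[X in _ *: X]/(_ * _) -exprD addnC exprD.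
Qed.

Lemma W_mx_sq x : W_mx (wq_sq x) = W_mx x *m W_mx x.
Proof.
rewrite [in LHS]/wq_sq linear_sum /= {2 3}(wq_span x).
elim: (index_enum _) => [|i s IHs]; first by rewrite !big_nil linear0 mul0mx.
rewrite !big_cons IHs linearD mulmxDl !mulmxDr [X in _ + (X + _)]W_mxC.
rewrite -addrA [X in _ = _ + X]addrA addKK add0r; congr (_ + _).
have WZ a y : W_mx (a *: y) = a *: W_mx y by rewrite linearZ.
rewrite -![GRing.Linear.sort _ _]/(W_mx _) !WZ !W_mx_e -scalemxAl -scalemxAr scalerA -expr2.
by rewrite -[X in _ = _ *: X]/(_ * _) -exprD addnn -mul2n -expnS.
Qed.

Fact W_linl v : linear (W_act^~ v).
Proof. by move=> a x y; rewrite /W_act linearP /= mulmxDr -scalemxAr. Qed.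
Fact W_linr x : linear (W_act x).
Proof. by move=> a v w; rewrite /W_act mulmxDl -scalemxAl. Qed.
Fact W_br x y v : W_act (@lbr K wq x y) v =
  W_act x (W_act y v) - W_act y (W_act x v).
Proof. by rewrite /W_act linear0 mulmx0 -!mulmxA W_mxC subrr. Qed.
Fact W_sq x v : W_act (@lsq K wq x) v = W_act x (W_act x v).
Proof. by rewrite /W_act W_mx_sq mulmxA. Qed.

Definition W : rmod wq :=
  @RMod K wq 'rV[K]_n W_act W_linl W_linr W_br W_sq.

Lemma W_e (v : W) : @act K wq W (wq_e 0) v = (v : 'rV_n) *m jordan n.
Proof. by rewrite /= /W_act W_mx_e expr1. Qed.
End JordanModule.

Lemma leq1q : (1 <= 2 ^ alpha)%N. Proof. by rewrite expn_gt0. Qed.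
End NilCyclic.

Arguments W [K] charK [alpha] n le_nq.

(* Main.v *)
(* Write W_n = K[x]/x^n with e acting as x, N = q/2, r = n - N and m = q - n, so
   that n = N + r and N = m + r. On X = S^2(W_n), e acts as a derivation "der" whose
   N-th power is the derivation given by x^N, as the characteristic is 2. An
   equivariant map from X to S^2(W_m) + W_q^r + W_1^r is built component by component:
   - to W_q, for N <= s < n: z is sent to the coefficients of e_s^2 in the der^j z;
   - to W_1, for l < r: z is sent to the sum of its coefficients in degree 2 l;
   - to S^2(W_m): the map S^2(tau), where tau divides by x^r and truncates, satisfies
     S^2(tau) der - der S^2(tau) = beta der^N for an explicit beta. Since der^N = 0 on
     S^2(W_m), subtracting \sum_(i < N) der^i beta der^(N - 1 - i) makes it equivariant.
   On a der-stable subspace, the coefficients of the e_s^2 with s > l determine those of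
   the e_a e_b with a <> b and a + b >= 2 l. Hence, by descending induction on s, the
   coefficients of all e_s^2, then all coefficients, vanish on the kernel, and both sides
   have the same dimension. *)
From HB Require Import structures.
Require Import Defs.
From mathcomp Require Import all_boot all_algebra.
From mathcomp Require Import zify ring.

Set Implicit Arguments.
Unset Strict Implicit.
Unset Printing Implicit Defensive.

Import GRing.Theory.
Local Open Scope ring_scope.

Lemma addKK_pchar2 (K : fieldType) (charK : 2%N \in [pchar K]) (V : lmodType K) (v : V) :
  v + v = 0.
Proof. by rewrite -mulr2n -scaler_nat (pcharf0 charK) scale0r. Qed.

(** * Bilinearity of the symmetric product *)

Section SymmetricSquare.
Variables (K : fieldType) (V : vectType K).

Lemma smul_linr (v : V) : linear (smul v).
Proof. exact: (smul_bilin V).1. Qed.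
HB.instance Definition _ (v : V) :=
  GRing.isLinear.Build K V (sym2 V) _ (smul v) (@smul_linr v).

Definition smulr (w v : V) := smul v w.
Lemma smulr_linear (w : V) : linear (smulr w).
Proof. exact: (smul_bilin V).2. Qed.
HB.instance Definition _ (w : V) :=
  GRing.isLinear.Build K V (sym2 V) _ (smulr w) (@smulr_linear w).

Lemma smulDl (u v w : V) : smul (u + v) w = smul u w + smul v w.
Proof. exact: (raddfD (smulr w)). Qed.
Lemma smulDr (u v w : V) : smul u (v + w) = smul u v + smul u w.
Proof. exact: (raddfD (smul u)). Qed.
Lemma smulZl a (v w : V) : smul (a *: v) w = a *: smul v w.
Proof. exact: (linearZ_LR (smulr w)). Qed.
Lemma smulZr a (v w : V) : smul v (a *: w) = a *: smul v w.
Proof. exact: linearZ_LR. Qed.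
Lemma smul_suml I (r : seq I) (P : pred I) (F : I -> V) (w : V) :
  smul (\sum_(i <- r | P i) F i) w = \sum_(i <- r | P i) smul (F i) w.
Proof. exact: (linear_sum (smulr w)). Qed.
Lemma smul_sumr I (r : seq I) (P : pred I) (F : I -> V) (v : V) :
  smul v (\sum_(i <- r | P i) F i) = \sum_(i <- r | P i) smul v (F i).
Proof. exact: (linear_sum (smul v)). Qed.
Lemma smul0l (w : V) : smul 0 w = 0.
Proof. exact: (raddf0 (smulr w)). Qed.
Lemma smul0r (v : V) : smul v 0 = 0.
Proof. exact: raddf0. Qed.

End SymmetricSquare.

(** * Coefficients and dimension of the symmetric square *)

Section Coordinates.
Variable (K : fieldType) (n : nat).

(* The coordinate v_a, with value 0 outside the range a < n. *)
Definition crd (v : 'rV[K]_n) (a : nat) : K :=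
  if insub a is Some i then v 0 i else 0.

Lemma crd_ord v (i : 'I_n) : crd v i = v 0 i.
Proof. by rewrite /crd valK. Qed.

Lemma crd_out v a : (n <= a)%N -> crd v a = 0.
Proof. by move=> le_na; rewrite /crd insubN // -leqNgt. Qed.

Lemma crd_linear a : linear (fun v => crd v a : K^o).
Proof.
move=> c v w; rewrite /crd; case: insubP => [i _ _|_]; first by rewrite !mxE.
by rewrite scaler0 addr0.
Qed.

Lemma crd0 a : crd 0 a = 0.
Proof. by rewrite /crd; case: insub => // i; rewrite mxE. Qed.

Lemma crdD v w a : crd (v + w) a = crd v a + crd w a.
Proof. by have := crd_linear a 1 v w; rewrite !scale1r. Qed.

Lemma crdZ c v a : crd (c *: v) a = c * crd v a.
Proof.
by have := crd_linear a c v 0; rewrite addr0 crd0 addr0.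
Qed.

Lemma crdM v (i : 'I_n) k :
  crd (v *m jordan K n ^+ k) i = if (k <= i)%N then crd v (i - k) else 0.
Proof.
rewrite crd_ord mxE; case: leqP => [le_ki | lt_ik]; last first.
  apply: big1 => j _; rewrite jordanX mxE gtn_eqF ?mulr0 //.
  by rewrite (leq_trans lt_ik) // leq_addl.
have lt_n : (i - k < n)%N by rewrite (leq_ltn_trans (leq_subr _ _)).
rewrite jordanX (bigD1 (Ordinal lt_n)) //= mxE /= subnK // eqxx mulr1.
rewrite big1 ?addr0 => [|j]; first by rewrite -crd_ord.
rewrite -val_eqE mxE /= => ne_j.
by rewrite (_ : (j + k == i)%N = false) ?mulr0 //; apply/eqP; lia.
Qed.

Lemma crdMX v a k : (a < n)%N ->
  crd (v *m jordan K n ^+ k) a = if (k <= a)%N then crd v (a - k) else 0.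
Proof. by move=> lt_an; rewrite -(crdM v (Ordinal lt_an)). Qed.

Lemma crdMS v a : (a.+1 < n)%N -> crd (v *m jordan K n) a.+1 = crd v a.
Proof. by move=> lt_an; rewrite -[jordan K n]expr1 crdMX //= subn1. Qed.

Lemma crdM0 v : crd (v *m jordan K n) 0 = 0.
Proof.
by case: (ltnP 0 n) => [n_gt0|/crd_out->//]; rewrite -[jordan K n]expr1 crdMX.
Qed.

Local Notation X := (sym2 'rV[K]_n).

(* For a != b, polar a b is the coefficient of e_a e_b; diag a is that of e_a^2. *)
Definition diag_form a (v w : 'rV[K]_n) : K^o := crd v a * crd w a.
Definition polar_form a b (v w : 'rV[K]_n) : K^o := crd v a * crd w b + crd v b * crd w a.
Definition diag a (z : X) : K^o := slift (diag_form a) z.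
Definition polar a b (z : X) : K^o := slift (polar_form a b) z.

Lemma diag_form_bilin a : bilin (diag_form a).
Proof.
by split=> u c v w; rewrite /diag_form crdD crdZ -[_ *: _]/(_ * _); ring.
Qed.

Lemma diag_formC a : commutative (diag_form a).
Proof. by move=> v w; rewrite /diag_form mulrC. Qed.

Lemma polar_form_bilin a b : bilin (polar_form a b).
Proof.
by split=> u c v w; rewrite /polar_form !crdD !crdZ -[_ *: _]/(_ * _); ring.
Qed.

Lemma polar_formC a b : commutative (polar_form a b).
Proof. by move=> v w; rewrite /polar_form; ring. Qed.

Lemma diagE a v w : diag a (smul v w) = crd v a * crd w a.
Proof. by rewrite /diag sliftE //; [apply: diag_form_bilin | apply: diag_formC]. Qed.

Lemma polarE a b v w : polar a b (smul v w) = crd v a * crd w b + crd v b * crd w a.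
Proof. by rewrite /polar sliftE //; [apply: polar_form_bilin | apply: polar_formC]. Qed.

Lemma diag_linear a : linear (diag a).
Proof. by apply: slift_linear; [apply: diag_form_bilin | apply: diag_formC]. Qed.
Lemma polar_linear a b : linear (polar a b).
Proof. by apply: slift_linear; [apply: polar_form_bilin | apply: polar_formC]. Qed.
HB.instance Definition _ a := GRing.isLinear.Build K X K^o _ (diag a) (@diag_linear a).
HB.instance Definition _ a b :=
  GRing.isLinear.Build K X K^o _ (polar a b) (@polar_linear a b).

Lemma polarC a b z : polar a b z = polar b a z.
Proof.
by apply: (sym2_ext (@polar_linear a b) (@polar_linear b a)) z => v w; rewrite !polarE addrC.
Qed.

Lemma linear_cst0 (U Z : lmodType K) : linear (fun _ : U => 0 : Z).
Proof. by move=> c x y; rewrite scaler0 addr0. Qed.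

Lemma diag_out a z : (n <= a)%N -> diag a z = 0.
Proof.
move=> le_na; apply: (sym2_ext (@diag_linear a) (@linear_cst0 X K^o)) z => v w.
by rewrite diagE crd_out // mul0r.
Qed.

Lemma polar_out a b z : (n <= b)%N -> polar a b z = 0.
Proof.
move=> le_nb; apply: (sym2_ext (@polar_linear a b) (@linear_cst0 X K^o)) z => v w.
by rewrite polarE !(crd_out _ le_nb) mulr0 mul0r addr0.
Qed.

Definition sym2_coef (ij : 'I_n * 'I_n) (z : X) : K^o :=
  if ij.1 == ij.2 then diag ij.1 z else polar ij.1 ij.2 z.

Lemma sym2_coef_linear ij : linear (sym2_coef ij).
Proof. by move=> c x y; rewrite /sym2_coef; case: eqP => _; rewrite linearP. Qed.

Local Notation ordered := [pred ij : 'I_n * 'I_n | ij.1 <= ij.2]%N.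
Local Notation E ij := (smul (delta_mx 0 ij.1 : 'rV[K]_n) (delta_mx 0 ij.2)).

Definition sym2_of_coef (c : 'I_n * 'I_n -> K) : X := \sum_(ij in ordered) c ij *: E ij.

Lemma sym2_of_coef_linear : linear (fun z => sym2_of_coef (sym2_coef^~ z)).
Proof.
move=> c x y; rewrite /sym2_of_coef scaler_sumr -big_split; apply: eq_bigr => ij _ /=.
by rewrite sym2_coef_linear scalerDl scalerA.
Qed.

Lemma sym2_coefK z : sym2_of_coef (sym2_coef^~ z) = z.
Proof.
have idlin : linear (@id X) by [].
apply: (sym2_ext sym2_of_coef_linear idlin) z => v w.
rewrite /sym2_of_coef (eq_bigr (fun ij : 'I_n * 'I_n => (v 0 ij.1 * w 0 ij.2) *: E ij +
   (if ij.1 == ij.2 then 0 else (v 0 ij.2 * w 0 ij.1) *: E ij))); last first.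
  move=> [i j] _ /=; rewrite /sym2_coef /=; case: eqP => [->|_].
    by rewrite diagE !crd_ord addr0.
  by rewrite polarE !crd_ord scalerDl.
rewrite big_split /=.
(* Swapping the indices turns the second half of each [polar] into the terms with [ij.1 > ij.2], so
   that the two halves run over all pairs. *)
have -> : \sum_(ij in ordered) (if ij.1 == ij.2 then 0 else (v 0 ij.2 * w 0 ij.1) *: E ij)
   = \sum_(ij : 'I_n * 'I_n | ~~ (ij.1 <= ij.2)%N) (v 0 ij.1 * w 0 ij.2) *: E ij.
  rewrite [RHS](reindex (fun ij => (ij.2, ij.1))) /=; last first.
    by exists (fun ij => (ij.2, ij.1)) => -[].
  rewrite (bigID (fun ij => ij.1 == ij.2)) /= big1 ?add0r => [|ij /andP[_ ->//]].
  apply: eq_big => [[i j]|[i j] /andP[_ /negPf/= ->]] /=; last by rewrite smulC.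
  by rewrite -ltnNge inE /= ltn_neqAle andbC.
rewrite -[LHS](bigID (fun ij : 'I_n * 'I_n => ij.1 <= ij.2)%N predT).
rewrite -(pair_bigA _ (fun i j => (v 0 i * w 0 j) *: E (i, j))) /=.
rewrite [in RHS](row_sum_delta v) [in RHS](row_sum_delta w) /= smul_suml.
apply: eq_bigr => i _; rewrite smul_sumr; apply: eq_bigr => j _.
by rewrite smulZr smulZl scalerA mulrC.
Qed.

Lemma sym2_coef_of (c : 'I_n * 'I_n -> K) ij : ij \in ordered ->
  sym2_coef ij (sym2_of_coef c) = c ij.
Proof.
move=> ord_ij.
have sumE : sym2_coef ij (sym2_of_coef c) = \sum_(kl in ordered) c kl * sym2_coef ij (E kl).
  pose L : {linear X -> K^o} :=
    HB.pack (sym2_coef ij) (GRing.isLinear.Build _ _ _ _ _ (sym2_coef_linear ij)).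
  rewrite -[LHS]/(L _) linear_sum; apply: eq_bigr => kl _.
  exact: linearZ_LR.
rewrite sumE (bigD1 ij) //= big1 ?addr0 => [|[k l] /andP[ord_kl ne]].
  rewrite /sym2_coef; case: eqP => [eq_ij|/eqP ne_ij].
    by rewrite diagE !crd_ord !mxE eq_ij !eqxx !mulr1.
  by rewrite polarE !crd_ord !mxE !eqxx (negPf ne_ij) mulr0 addr0 !mulr1.
move: ord_ij ord_kl ne; case: ij {sumE} => i j; rewrite !inE /= xpair_eqE => ij kl ne.
rewrite /sym2_coef /=; case: (eqVneq i j) => [eq_ij|ne_ij].
  rewrite diagE !crd_ord !mxE !eqxx /= -eq_ij in kl ne *.
  by move: ne; rewrite eq_sym [l == _]eq_sym; do 2!case: eqP => _; rewrite ?(mulr0, mul0r).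
rewrite polarE !crd_ord !mxE !eqxx /=.
rewrite -!natrM !mulnb [i == k]eq_sym [j == l]eq_sym (negPf ne) add0r.
case: eqP => [eq_jk|_]; last by rewrite mulr0.
case: eqP => [eq_il|_]; last by rewrite mulr0.
by case/eqP: ne_ij; apply/val_inj/eqP; rewrite eqn_leq ij eq_jk eq_il.
Qed.

Lemma dim_sym2 : \dim {:X} = #|ordered|.
Proof.
pose f z : 'rV[K]_#|ordered| := \row_k sym2_coef (enum_val k) z.
have f_lin : linear f by move=> c x y; apply/rowP => k; rewrite !mxE sym2_coef_linear.
pose L : {linear X -> 'rV[K]_#|ordered|} :=
  HB.pack f (GRing.isLinear.Build _ _ _ _ _ f_lin).
have inj_L : injective L.
  move=> x y eq_xy; rewrite -(sym2_coefK x) -(sym2_coefK y) /sym2_of_coef.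
  apply: eq_bigr => ij ord_ij; congr (_ *: _).
  by move/rowP: eq_xy => /(_ (enum_rank_in ord_ij ij)); rewrite !mxE enum_rankK_in.
have surj_L : limg (linfun L) = fullv.
  apply/eqP; rewrite eqEsubv subvf; apply/subvP => r _.
  pose c ij := if insub ij is Some u
    then r 0 (enum_rank_in (valP (u : {ij | ij \in ordered})) ij) else 0.
  apply/memv_imgP; exists (sym2_of_coef c); rewrite ?memvf // lfunE.
  apply/rowP => k; rewrite mxE sym2_coef_of ?enum_valP // /c insubT ?enum_valP // => Pk.
  by congr (r 0 _); apply: enum_val_inj; rewrite enum_rankK_in ?enum_valP.
have ker0 : lker (linfun L) == 0%VS.
  by apply/lker0P => x y; rewrite !lfunE => /inj_L.
have := limg_ker_dim (linfun L) fullv.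
by rewrite surj_L (eqP ker0) capv0 dimv0 add0n => <-; rewrite dimvf [dim _]mul1n.
Qed.

Lemma card_ordered : #|ordered| = 'C(n.+1, 2).
Proof.
rewrite -sum1_card -(pair_big_dep predT (fun i j : 'I_n => (i <= j)%N) (fun _ _ => 1%N)) /=.
(* Each [j] has [j + 1] indices [i <= j], which gives the sum of the integers up to [n]. *)
rewrite (exchange_big_dep predT) //= -bin2_sum big_mkord big_ord_recl add0n.
apply: eq_bigr => j _; rewrite -(big_ord_widen n (fun=> 1%N) (ltn_ord j)).
by rewrite sum1_card card_ord.
Qed.

End Coordinates.

(** * Closure properties of linearity *)

Section LinearMaps.
Variable K : fieldType.

Lemma comp_linear (U V Z : lmodType K) (f : V -> Z) (g : U -> V) :
  linear f -> linear g -> linear (fun x => f (g x)).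
Proof. by move=> f_lin g_lin a x y; rewrite g_lin f_lin. Qed.

Lemma add_linear (U Z : lmodType K) (f g : U -> Z) :
  linear f -> linear g -> linear (fun x => f x + g x).
Proof. by move=> f_lin g_lin a x y; rewrite f_lin g_lin scalerDr addrACA. Qed.

Lemma sub_linear (U Z : lmodType K) (f g : U -> Z) :
  linear f -> linear g -> linear (fun x => f x - g x).
Proof. by move=> f_lin g_lin a x y; rewrite f_lin g_lin scalerBr opprD addrACA. Qed.

Lemma scale_linear (U Z : lmodType K) (f : U -> Z) b :
  linear f -> linear (fun x => b *: f x).
Proof. by move=> f_lin a x y; rewrite f_lin scalerDr !scalerA mulrC. Qed.

Lemma sum_linear (U Z : lmodType K) I (r : seq I) (F : I -> U -> Z) :
  (forall i, linear (F i)) -> linear (fun x => \sum_(i <- r) F i x).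
Proof.
move=> F_lin a x y; rewrite scaler_sumr -big_split; apply: eq_bigr => i _.
exact: F_lin.
Qed.

Lemma iter_linear (U : lmodType K) (f : U -> U) k : linear f -> linear (iter k f).
Proof. by move=> f_lin; elim: k => [//|k IHk] a x y; rewrite !iterS (IHk a x y) f_lin. Qed.

End LinearMaps.

(** * Derivations of the symmetric square in characteristic 2 *)

Section Derivation.
Variables (K : fieldType) (charK : 2%N \in [pchar K]) (n : nat).
Local Notation X := (sym2 'rV[K]_n).
Implicit Types (A : 'M[K]_n) (v w : 'rV[K]_n) (z : X).

Local Notation addKK := (addKK_pchar2 charK).

(** Stated for any matrix, because the [2 ^ k]-th iterate of a derivation is again one, given by
    [A ^+ (2 ^ k)]. *)
Definition sder_form A v w : X := smul (v *m A) w + smul v (w *m A).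
Definition sder A z : X := slift (sder_form A) z.

Lemma sder_form_bilin A : bilin (sder_form A).
Proof.
by split=> u a v w; rewrite /sder_form !mulmxDl -!scalemxAl !(smulDl, smulDr, smulZl, smulZr)
  scalerDr addrACA.
Qed.

Lemma sder_formC A : commutative (sder_form A).
Proof. by move=> v w; rewrite /sder_form addrC; congr (_ + _); apply: smulC. Qed.

Lemma sderE A v w : sder A (smul v w) = smul (v *m A) w + smul v (w *m A).
Proof. by rewrite /sder sliftE //; [apply: sder_form_bilin | apply: sder_formC]. Qed.

Lemma sder_linear A : linear (sder A).
Proof. by apply: slift_linear; [apply: sder_form_bilin | apply: sder_formC]. Qed.
HB.instance Definition _ A := GRing.isLinear.Build K X X _ (sder A) (@sder_linear A).

Lemma sder0 z : sder 0 z = 0.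
Proof.
apply: (sym2_ext (@sder_linear 0) (@linear_cst0 K X X)) z => v w.
by rewrite sderE !mulmx0 smul0l smul0r addr0.
Qed.

(** The two cross terms both equal [smul (v *m A) (w *m A)] and cancel in characteristic 2. *)
Lemma sder_sq A z : sder A (sder A z) = sder (A *m A) z.
Proof.
apply: (sym2_ext (comp_linear (@sder_linear A) (@sder_linear A)) (@sder_linear _)) z => v w.
rewrite !sderE linearD /= !sderE !mulmxA -addrA; congr (_ + _).
by rewrite addrA addKK add0r.
Qed.

Lemma iter_sder A k z : iter (2 ^ k) (sder A) z = sder (A ^+ (2 ^ k)) z.
Proof.
elim: k z => [|k IHk] z; first by rewrite expn0 expr1.
by rewrite expnS mul2n -addnn iterD !IHk sder_sq exprD.
Qed.

Local Notation der := (sder (jordan K n)).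

Lemma polar_diag a z : polar a a z = 0.
Proof.
apply: (sym2_ext (@polar_linear K n a a) (@linear_cst0 K X K^o)) z => v w.
by rewrite polarE -[RHS](addKK (crd v a * crd w a : K^o)).
Qed.

Lemma diag_der0 z : diag 0 (der z) = 0.
Proof.
apply: (sym2_ext (comp_linear (@diag_linear _ _ 0) (@sder_linear _))
  (@linear_cst0 K X K^o)) z => v w.
by rewrite sderE raddfD /= !diagE !crdM0 mul0r mulr0 addr0.
Qed.

(** Under [der], [e_(a+1)^2] arises only from [e_a e_(a+1)]. This is how the squares, followed along
    [der], detect mixed coefficients. *)
Lemma diag_derS a z : (a.+1 < n)%N -> diag a.+1 (der z) = polar a a.+1 z.
Proof.
move=> lt_an.
apply: (sym2_ext (comp_linear (@diag_linear _ _ a.+1) (@sder_linear _))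
  (@polar_linear _ _ _ _)) z => v w.
by rewrite sderE raddfD /= !diagE polarE !crdMS.
Qed.

Lemma polar_der0 b z : (b.+1 < n)%N -> polar 0 b.+1 (der z) = polar 0 b z.
Proof.
move=> lt_bn.
apply: (sym2_ext (comp_linear (@polar_linear _ _ 0 b.+1) (@sder_linear _))
  (@polar_linear _ _ _ _)) z => v w.
by rewrite sderE raddfD /= !polarE !crdMS // !crdM0; ring.
Qed.

Lemma polar_derS a b z : (a.+1 < n)%N -> (b.+1 < n)%N ->
  polar a.+1 b.+1 (der z) = polar a b.+1 z + polar a.+1 b z.
Proof.
move=> lt_an lt_bn.
apply: (sym2_ext (comp_linear (@polar_linear _ _ a.+1 b.+1) (@sder_linear _))
  (add_linear (@polar_linear _ _ a b.+1) (@polar_linear _ _ a.+1 b))) z => v w.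
by rewrite sderE raddfD /= !polarE !crdMS //; ring.
Qed.

(* The forms diag s, with s > l, generate the forms polar a b, with a + b >= 2 l, *)
(* under the action of der.                                                       *)
Lemma polar_stable_eq0 (M : X -> Prop) l :
    (forall z, M z -> M (der z)) ->
    (forall s z, (l < s < n)%N -> M z -> diag s z = 0) ->
  forall a b z, (a < b)%N -> (l.*2 <= a + b)%N -> M z -> polar a b z = 0.
Proof.
move=> M_der M_diag.
suff H d : forall a z, (l.*2 <= a + (a + d))%N -> M z -> polar a (a + d) z = 0.
  by move=> a b z lt_ab le_l Mz; rewrite -(subnKC (ltnW lt_ab)) H ?subnKC // ltnW.
have [k] := ubnP d; elim: k d => // k IHk d lt_dk a z le_l Mz.
case: (ltnP (a + d) n) => [lt_n | /polar_out-> //].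
case: d => [|[|d]] in lt_dk le_l lt_n *.
- by rewrite addn0 polar_diag.
- by rewrite addn1 in lt_n le_l *; rewrite -diag_derS // M_diag //; [lia | exact: M_der].
(* [polar_derS] expresses gap [d.+2] at [z] through gap [d.+1] at [der z] and gap [d] at [z],
   without lowering the degree. *)
have lt_an : (a.+1 < n)%N by lia.
have := polar_derS z lt_an (b := a + d.+1); rewrite -addnS => /(_ lt_n).
rewrite -[(a + d.+1)%N]addSnnS [in X in X = _]addnS -addSn [X in X = _]IHk //; try lia.
  by rewrite [X in _ + X]IHk // ?addr0; [move=> <- | lia..].
exact: M_der.
Qed.

(** [der] raises degrees by 1, and the bound moves along. The threshold is [D - F], kept as two
    naturals since it may be negative. *)
Lemma der_filtration D F z :
    (forall a b, (D <= a + b + F)%N -> polar a b z = 0) ->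
  forall i a b, (D + i <= a + b + F)%N -> polar a b (iter i der z) = 0.
Proof.
move=> z0 i; elim: i => [|i IHi] a b; first by rewrite addn0; apply: z0.
case: (ltnP a n) => [lt_an|le_na]; last by rewrite polarC polar_out.
case: (ltnP b n) => [lt_bn|/polar_out-> //].
rewrite addnS /=; case: a b lt_an lt_bn => [|a] [|b] lt_an lt_bn le_D.
- by rewrite polar_diag.
- by rewrite polar_der0 // IHi //; lia.
- by rewrite polarC polar_der0 // polarC IHi //; lia.
by rewrite polar_derS // !IHi ?addr0 //; lia.
Qed.

End Derivation.

(** * Equivariant maps to [W_q] and [W_1], and [der]-stable subspaces *)

Section InvariantForms.
Variables (K : fieldType) (charK : 2%N \in [pchar K]) (n : nat).
Local Notation X := (sym2 'rV[K]_n).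
Local Notation der := (sder (jordan K n)).
Implicit Types (v w : 'rV[K]_n) (z : X).

Local Notation addKK := (addKK_pchar2 charK).

(** After one [der], a square coefficient is 0 or a mixed one in one degree lower, to which
    [der_filtration] applies. *)
Lemma diag_filtration D F z :
    (forall a, (D <= a.*2 + F)%N -> diag a z = 0) ->
    (forall a b, (D <= a + b + F)%N -> polar a b z = 0) ->
  forall i a, (D + i <= a.*2 + F)%N -> diag a (iter i der z) = 0.
Proof.
move=> diag0 polar0 [|i] a; first by rewrite addn0; apply: diag0.
case: (ltnP a n) => [lt_an|/diag_out-> //].
case: a lt_an => [|a] lt_an le_D; first by rewrite /= diag_der0.
by rewrite /= diag_derS // (der_filtration charK polar0) //; lia.
Qed.

Lemma iter_der_nil k z : (n <= 2 ^ k)%N -> iter (2 ^ k) der z = 0.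
Proof. by move=> le_n; rewrite iter_sder // jordan_nil // sder0. Qed.

(* The sum of the coefficients of z in degree 2 l: der kills it because, in odd     *)
(* degree, each e_a e_b is sent to the sum of two basis elements.                  *)
Definition augm l z : K^o := diag l z + \sum_(a < l) polar a (l.*2 - a) z.

Lemma augm_linear l : linear (augm l).
Proof.
apply: add_linear; first exact: diag_linear.
by apply: sum_linear => a; apply: polar_linear.
Qed.

Lemma augm_der l z : (l.*2 < n)%N -> augm l (der z) = 0.
Proof.
(* For [a > 0], [f a] is the coefficient of [e_(a-1) e_(2l-a)] in [z]. The sum telescopes to [f l],
   which equals [diag l (der z)], and the two cancel. *)
move=> lt_ln; pose f a : K^o := if a is a'.+1 then polar a' (l.*2 - a) z else 0.
have sumf k : \sum_(a < k) (f a + f a.+1) = f k.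
  elim: k => [|k IHk]; first by rewrite big_ord0.
  by rewrite big_ord_recr /= IHk addrA addKK add0r.
rewrite /augm (eq_bigr (fun a : 'I_l => f a + f a.+1)) => [|[a lt_al] _] /=; last first.
  case: a lt_al => [|a] lt_al.
    have [b def_b] : exists b, l.*2 = b.+1 by exists l.*2.-1; lia.
    by rewrite add0r def_b subn0 subn1 polar_der0 // -def_b.
  have [b def_b] : exists b, (l.*2 - a.+1)%N = b.+1 by exists (l.*2 - a.+2)%N; lia.
  have -> : (l.*2 - a.+2 = b)%N by lia.
  by rewrite /f def_b polar_derS //; lia.
rewrite sumf; case: l lt_ln @f sumf => [|l] lt_ln f sumf.
  by rewrite diag_der0 addr0.
rewrite diag_derS /f; last by lia.
by rewrite -addnn addnK addKK.
Qed.

(** Any linear form yields such a map to [W_q], which is cofree over [K[e]/e^q]. The order is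
    reversed because [jordan] moves coordinate [t] to [t + 1]. *)
Definition orbit_form q s z : 'rV[K]_q := \row_t diag s (iter (q.-1 - t) der z).

Lemma crd_orbit q s z a : (a < q)%N ->
  crd (orbit_form q s z) a = diag s (iter (q.-1 - a) der z).
Proof. by move=> lt_aq; rewrite -[a]/(val (Ordinal lt_aq)) crd_ord mxE. Qed.

Lemma orbit_form_linear q s : linear (orbit_form q s).
Proof.
move=> c x y; apply/rowP => t; rewrite !mxE.
have it_lin := iter_linear (q.-1 - t) (@sder_linear K n (jordan K n)).
by rewrite (it_lin c x y) linearP.
Qed.

Lemma orbit_form_der k s z : (n <= 2 ^ k)%N ->
  orbit_form (2 ^ k) s (der z) = orbit_form (2 ^ k) s z *m jordan K (2 ^ k).
Proof.
move=> le_n; apply/rowP => -[[|t] lt_t]; rewrite -crd_ord -[in RHS]crd_ord /=.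
  rewrite crdM0 crd_orbit // subn0 -iterSr prednK ?expn_gt0 //.
  by rewrite iter_der_nil // raddf0.
rewrite crdMS // !crd_orbit ?(ltnW lt_t) //.
by rewrite -iterSr; congr (diag s (iter _ der z)); lia.
Qed.

Section Kernel.
Variables (M : X -> Prop) (M_der : forall z, M z -> M (der z)).

Lemma stable_diag_eq0 : (forall s z, M z -> diag s z = 0) -> forall z, M z -> z = 0.
Proof.
move=> M_diag z Mz; rewrite -(sym2_coefK z) /sym2_of_coef big1 // => -[i j] /= le_ij.
rewrite /sym2_coef /=; case: eqP => [_|/eqP ne_ij]; first by rewrite M_diag // scale0r.
rewrite (polar_stable_eq0 charK (M := M) (l := 0)) ?scale0r //.
  by move=> s y _; apply: M_diag.
by rewrite ltn_neqAle ne_ij.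
Qed.

(** The mixed terms of [augm l] have degree [l.*2], so [polar_stable_eq0] applies to them. *)
Lemma augm_diag l z :
    (forall s y, (l < s < n)%N -> M y -> diag s y = 0) -> M z ->
  augm l z = diag l z.
Proof.
move=> M_diag Mz; rewrite /augm big1 ?addr0 // => a _.
by rewrite (polar_stable_eq0 charK M_der M_diag) //; have := ltn_ord a; lia.
Qed.

End Kernel.
End InvariantForms.

(** * The equivariant map to [S^2(W_m)], and joint injectivity *)

Section Splitting.
Variables (K : fieldType) (charK : 2%N \in [pchar K]).
Variables (k n m r : nat).
Local Notation N := (2 ^ k)%N.
Local Notation q := (2 ^ k.+1)%N.
Hypotheses (r_gt0 : (0 < r)%N) (def_n : n = (N + r)%N) (def_N : N = (m + r)%N).
Local Notation X := (sym2 'rV[K]_n).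
Local Notation Y := (sym2 'rV[K]_m).
Local Notation der n := (sder (jordan K n)).
Implicit Types (v w : 'rV[K]_n) (z : X).

Let def_q : q = (N + N)%N. Proof. by rewrite expnS mul2n addnn. Qed.
Let n_gt0 : (0 < n)%N. Proof. by rewrite def_n ltn_addl. Qed.

(* Division by x^r followed by truncation, from K[x]/x^n to K[x]/x^m.              *)
Definition tau v : 'rV[K]_m := \row_i crd v (r + i).
Definition e0 : 'rV[K]_m := \row_i (i == 0 :> nat)%:R.

Lemma tau_linear : linear tau.
Proof. by move=> c v w; apply/rowP => i; rewrite !mxE crdD crdZ. Qed.
HB.instance Definition _ := GRing.isLinear.Build K _ _ _ tau tau_linear.

Lemma crd_tau v a : (a < m)%N -> crd (tau v) a = crd v (r + a).
Proof. by move=> lt_am; rewrite -[a]/(val (Ordinal lt_am)) crd_ord mxE. Qed.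

Lemma crd_e0 a : (a < m)%N -> crd e0 a = (a == 0)%:R.
Proof. by move=> lt_am; rewrite -[a]/(val (Ordinal lt_am)) crd_ord mxE. Qed.

(** Multiplication by [x] moves coordinate [r.-1], which [tau] drops, to index [r], which [tau]
    reads as the constant term. *)
Lemma tau_jordan v : tau (v *m jordan K n) = tau v *m jordan K m + crd v r.-1 *: e0.
Proof.
apply/rowP => -[a lt_am]; rewrite -crd_ord -[RHS]crd_ord /= crdD crdZ crd_tau //.
rewrite crd_e0 //; case: a lt_am => [|a] lt_am.
  by rewrite addn0 crdM0 add0r mulr1 -{1}(prednK r_gt0) crdMS //; lia.
by rewrite addnS crdMS ?crdMS ?crd_tau ?mulr0 ?addr0 //; lia.
Qed.

Lemma tau_shift v : tau (v *m jordan K n ^+ N) = 0.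
Proof.
apply/rowP => i; rewrite !mxE crdMX; last by have := ltn_ord i; lia.
by rewrite leqNgt def_N addnC ltn_add2r ltn_ord.
Qed.

Definition sym_tau_form v w : Y := smul (tau v) (tau w).
Definition sym_tau z : Y := slift sym_tau_form z.

(** The defect [crd v r.-1] of [tau_jordan] is coordinate [n.-1] of [v *m jordan K n ^+ N], as
    [n - 1 - N = r - 1]; hence the reading at [n.-1]. *)
Definition beta_form v w : Y := smul e0 (crd v n.-1 *: tau w + crd w n.-1 *: tau v).
Definition beta z : Y := slift beta_form z.

Lemma sym_tau_bilin : bilin sym_tau_form.
Proof.
by split=> u c v w; rewrite /sym_tau_form linearP ?smulDr ?smulDl ?smulZl ?smulZr.
Qed.
Lemma sym_tau_formC : commutative sym_tau_form.
Proof. by move=> v w; apply: smulC. Qed.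

Lemma beta_form_bilin : bilin beta_form.
Proof.
by split=> u c v w; rewrite /beta_form -smulZr -smulDr; congr smul;
  rewrite (tau_linear c) crdD crdZ !scalerDr !scalerDl !scalerA addrACA;
  rewrite [c * crd u _]mulrC.
Qed.
Lemma beta_formC : commutative beta_form.
Proof. by move=> v w; rewrite /beta_form addrC. Qed.

Lemma sym_tauE v w : sym_tau (smul v w) = smul (tau v) (tau w).
Proof. by rewrite /sym_tau sliftE //; [apply: sym_tau_bilin | apply: sym_tau_formC]. Qed.
Lemma betaE v w :
  beta (smul v w) = smul e0 (crd v n.-1 *: tau w + crd w n.-1 *: tau v).
Proof. by rewrite /beta sliftE //; [apply: beta_form_bilin | apply: beta_formC]. Qed.
Lemma sym_tau_linear : linear sym_tau.
Proof. by apply: slift_linear; [apply: sym_tau_bilin | apply: sym_tau_formC]. Qed.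
Lemma beta_linear : linear beta.
Proof. by apply: slift_linear; [apply: beta_form_bilin | apply: beta_formC]. Qed.
HB.instance Definition _ := GRing.isLinear.Build K X Y _ sym_tau sym_tau_linear.
HB.instance Definition _ := GRing.isLinear.Build K X Y _ beta beta_linear.

Lemma diag_sym_tau a z : (a < m)%N -> diag a (sym_tau z) = diag (r + a) z.
Proof.
move=> lt_am; apply: (sym2_ext (comp_linear (@diag_linear _ _ a) sym_tau_linear)
  (@diag_linear _ _ _)) z => v w.
by rewrite sym_tauE !diagE !crd_tau.
Qed.

Lemma diag_beta a z : (a < m)%N ->
  diag a (beta z) = (a == 0)%:R *: polar (r + a) n.-1 z.
Proof.
move=> lt_am; apply: (sym2_ext (comp_linear (@diag_linear _ _ a) beta_linear)
  (scale_linear (a == 0)%:R (@polar_linear K n (r + a) n.-1))) z => v w.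
rewrite betaE diagE polarE crdD !crdZ !crd_tau // crd_e0 //.
by congr (_ * _); ring.
Qed.

Lemma polar_beta a b z : (a < m)%N -> (b < m)%N ->
  polar a b (beta z) = (a == 0)%:R *: polar (r + b) n.-1 z
                     + (b == 0)%:R *: polar (r + a) n.-1 z.
Proof.
move=> lt_am lt_bm; apply: (sym2_ext (comp_linear (@polar_linear _ _ a b) beta_linear)
  (add_linear (scale_linear (a == 0)%:R (@polar_linear K n (r + b) n.-1))
     (scale_linear (b == 0)%:R (@polar_linear K n (r + a) n.-1)))) z => v w.
rewrite betaE !polarE !crdD !crdZ !crd_tau // !crd_e0 // -![_ *: _]/(_ * _).
ring.
Qed.

(* sym_tau fails to be equivariant only at the boundary of the range of tau, and *)
(* this failure factors through the N-th power of the derivation.                *)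
Lemma sym_tau_der z :
  sym_tau (der n z) = der m (sym_tau z) + beta (iter N (der n) z).
Proof.
rewrite iter_sder //; apply: (sym2_ext
  (comp_linear sym_tau_linear (@sder_linear _ _ _))
  (add_linear (comp_linear (@sder_linear _ _ _) sym_tau_linear)
     (comp_linear beta_linear (@sder_linear _ _ _)))) z => v w.
rewrite sym_tauE !sderE !linearD /= !sym_tauE !betaE !tau_shift !tau_jordan.
rewrite !scaler0 addr0 add0r !crdMX ?prednK // (_ : (N <= n.-1)%N); last by lia.
rewrite (_ : (n.-1 - N)%N = r.-1); last by lia.
rewrite !smulDl !smulDr !smulZl !smulZr [smul (tau v) e0]smulC.
by rewrite addrACA.
Qed.

Definition retract z : Y :=
  sym_tau z - \sum_(i < N) iter i (der m) (beta (iter (N.-1 - i) (der n) z)).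

Lemma retract_linear : linear retract.
Proof.
apply: sub_linear; first exact: sym_tau_linear.
apply: sum_linear => i.
exact: comp_linear (iter_linear _ (@sder_linear _ _ _))
  (comp_linear beta_linear (iter_linear _ (@sder_linear _ _ _))).
Qed.

Lemma retract_der z : retract (der n z) = der m (retract z).
Proof.
(* The two correction sums are shifts of each other: they differ by [g 0], the defect in
   [sym_tau_der], and by [g N], which is 0 because [m <= N]. *)
pose g i := iter i (der m) (beta (iter (N - i) (der n) z)).
have sum1 : \sum_(i < N) iter i (der m) (beta (iter (N.-1 - i) (der n) (der n z)))
          = \sum_(i < N) g i.
  apply: eq_bigr => i _; rewrite -iterSr /g.
  by have -> : ((N.-1 - i).+1 = N - i)%N by have := ltn_ord i; lia.
have sum2 : der m (\sum_(i < N) iter i (der m) (beta (iter (N.-1 - i) (der n) z)))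
          = \sum_(i < N) g i.+1.
  rewrite linear_sum; apply: eq_bigr => i _; rewrite -iterS /g.
  by have -> : (N.-1 - i = N - i.+1)%N by lia.
have telescope : \sum_(i < N) g i = \sum_(i < N) g i.+1 + beta (iter N (der n) z).
  have gN : g N = 0 by rewrite /g iter_der_nil //; lia.
  have := erefl (\sum_(i < N.+1) g i).
  by rewrite {1}big_ord_recl big_ord_recr /= gN addr0 => <-; rewrite addrC {2}/g subn0.
rewrite /retract sum1 telescope sym_tau_der linearB /= sum2.
by rewrite opprD addrACA subrr addr0.
Qed.

Lemma split_injective z : retract z = 0 ->
    (forall s, (s < r)%N -> orbit_form q (N + s) z = 0) ->
    (forall l, (l < r)%N -> augm l z = 0) ->
  z = 0.
Proof.
move=> retr0 orb0 augm0.
pose M z := [/\ retract z = 0,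
    forall s, (s < r)%N -> orbit_form q (N + s) z = 0
  & forall l, (l < r)%N -> augm l z = 0].
have M_der y : M y -> M (der n y).
  case=> My1 My2 My3; split=> [|s lt_sr|l lt_lr].
  - by rewrite retract_der My1 linear0.
  - by rewrite orbit_form_der ?My2 ?mul0mx //; lia.
  by rewrite augm_der //; lia.
have M_iter j y : M y -> M (iter j (der n) y).
  by move=> My; elim: j => //= j; apply: M_der.
apply: (stable_diag_eq0 charK M_der) => // s.
(* Descending induction on [s]: [augm] settles [s < r], [orbit_form] settles [N <= s < n], and
   [retract] the range between. *)
have [d] := ubnP (n - s); elim: d s => // d IHd s lt_d y My.
have [ge_n|lt_n] := leqP n s; first by rewrite diag_out.
have M_diag s' x : (s < s' < n)%N -> M x -> diag s' x = 0.
  by move=> lt_s Mx; apply: IHd => //; lia.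
have [retr_y orb_y augm_y] := My.
have [lt_sr | le_rs] := ltnP s r.
  by rewrite -(augm_diag charK M_der M_diag My) augm_y.
have [le_Ns | lt_sN] := leqP N s.
  (* The last coordinate of the orbit involves no [der]: it is [diag s y] itself. *)
  have lt_q : (q.-1 < q)%N by lia.
  have := crd_orbit s y lt_q; rewrite subnn /= => <-.
  by rewrite -(subnKC le_Ns) orb_y ?crd0 //; lia.
have lt_sm : (s - r < m)%N by lia.
(* On the kernel [sym_tau y] equals the correction sum; each of its terms has coefficient 0 at
   [e_(s-r)^2]. *)
rewrite -(subnKC le_rs) -diag_sym_tau // (subr0_eq retr_y) raddf_sum big1 //= => i _.
have Mw : M (iter (N.-1 - i) (der n) y) by apply: M_iter.
move: (iter _ _ y) Mw => w Mw.
have polar_w b : (s.*2 <= r + b + n.-1)%N -> (b < m)%N -> polar (r + b) n.-1 w = 0.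
  by move=> le_s lt_bm; apply: (polar_stable_eq0 charK M_der M_diag) => //; lia.
(* The coefficient of [e_0 e_b] in [beta w] is [polar (r + b) n.-1 w], in degree [b + N + 2r - 1],
   so it vanishes once [2(s-r) + 1 <= b + N]. As [i < N], the bound raised by [i] still covers
   degree [2(s-r)]. *)
apply: (diag_filtration charK (D := (s - r).*2.+1) (F := N)) => [a le_a|a b le_ab|].
- have [lt_am|/diag_out->//] := ltnP a m.
  rewrite diag_beta //; case: eqP => [a0|_]; last by rewrite scale0r.
  by rewrite polar_w ?scaler0 //; lia.
- have [lt_am|le_ma] := ltnP a m; last by rewrite polarC polar_out.
  have [lt_bm|/polar_out->//] := ltnP b m.
  have term0 c d' : (d' < m)%N -> (c = 0%N -> a + b = d')%N ->
      (c == 0)%:R *: polar (r + d') n.-1 w = 0.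
    move=> lt_d' eq_d'; case: eqP => [/eq_d' def_d'|_]; last by rewrite scale0r.
    by rewrite polar_w ?scaler0 //; lia.
  by rewrite polar_beta // !term0 ?addr0 //; lia.
by have := ltn_ord i; lia.
Qed.
End Splitting.

(** * Bijectivity by dimension, and equivariance under all of [wq] *)

Lemma injective_bijective (K : fieldType) (U V : vectType K) (f : {linear U -> V}) :
  injective f -> \dim {:U} = \dim {:V} -> bijective f.
Proof.
move=> inj_f eq_dim.
have ker0 : lker (linfun f) == 0%VS by apply/lker0P => x y; rewrite !lfunE => /inj_f.
have limgf : limg (linfun f) = fullv.
  apply/eqP; rewrite eqEdim subvf /= -eq_dim limg_dim_eq //.
  by rewrite (eqP ker0) capv0.
exists ((linfun f)^-1)%VF => x; first by rewrite -[f x]lfunE lker0_lfunK.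
by rewrite -[f _]lfunE limg_lfunVK // limgf memvf.
Qed.

Section Equivariance.
Variables (K : fieldType) (charK : 2%N \in [pchar K]) (alpha : nat).
Local Notation g := (wq charK alpha).
Local Notation e := (wq_e K alpha 0 : g).

(** By [act_sq], commutation passes from [e] to its iterated 2-powers, and these span [wq]. *)
Lemma wq_equivariant (U V : rmod g) (f : {linear U -> V}) :
    (forall v, f (act e v) = act e (f v)) ->
  forall (x : g) v, f (act x v) = act x (f v).
Proof.
move=> f_e x v.
have f_ek k : forall u, f (act (wq_e K alpha k : g) u) = act (wq_e K alpha k : g) (f u).
  elim: k => // k IHk u.
  have <- : @lsq K g (wq_e K alpha k) = wq_e K alpha k.+1 by apply: wq_sq_e.
  by rewrite !act_sq !IHk.
have -> : x = \sum_(i < alpha) (x : 'rV_alpha) 0 i *: (wq_e K alpha i : g).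
  exact: wq_span.
elim: (index_enum _) => [|i s IHs].
  have act0 (Z : rmod g) (z : Z) : act (0 : g) z = 0.
    by have := act_linl z (-1) (0 : g) 0; rewrite scaler0 addr0 scaleN1r addNr.
  by rewrite big_nil !act0 linear0.
by rewrite big_cons !act_linl linearP IHs f_ek.
Qed.

Lemma symsq_e n (le_nq : (n <= 2 ^ alpha)%N) (z : sym2 'rV[K]_n) :
  @act K g (symsq charK (W charK n le_nq)) e z = sder (jordan K n) z.
Proof.
apply: (sym2_ext (@sym2_linr K g (W charK n le_nq) e) (@sder_linear K n (jordan K n))) z.
move=> v w.
by rewrite sym2_actE sderE !W_e.
Qed.

End Equivariance.

(** * Assembly of the isomorphism *)

Theorem theorem1p9 (K : fieldType) (charK : 2%N \in [pchar K]) (alpha n : nat)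
    (alpha_gt0 : (0 < alpha)%N)
    (n_gt : (2 ^ alpha %/ 2 < n)%N) (n_le : (n <= 2 ^ alpha)%N) :
  rmod_iso
    (symsq charK (W charK n n_le))
    (dsum (symsq charK (W charK (2 ^ alpha - n)%N (leq_subr n (2 ^ alpha))))
       (dsum (copies (W charK (2 ^ alpha)%N (leqnn (2 ^ alpha)))
                     (n - 2 ^ alpha %/ 2))
             (copies (W charK 1 (leq1q alpha)) (n - 2 ^ alpha %/ 2)))).
Proof.
case: alpha alpha_gt0 n_gt n_le => // k _ n_gt n_le.
have def_h : (2 ^ k.+1 %/ 2 = 2 ^ k)%N by rewrite expnS mulKn.
have def_q : (2 ^ k.+1 = 2 ^ k + 2 ^ k)%N by rewrite expnS mul2n addnn.
set V := symsq _ _; set T := dsum _ _.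
set m := (2 ^ k.+1 - n)%N in T *; set r := (n - 2 ^ k.+1 %/ 2)%N in T *.
have r_gt0 : (0 < r)%N by rewrite subn_gt0.
have def_n : n = (2 ^ k + r)%N by rewrite /r def_h; lia.
have def_N : (2 ^ k = m + r)%N by rewrite /r /m def_h; lia.
pose F (z : sym2 'rV[K]_n) : T :=
  (retract k m r z, ([ffun i : 'I_r => orbit_form (2 ^ k.+1) (2 ^ k + i) z],
    [ffun i : 'I_r => const_mx (augm i z) : 'rV[K]_1])).
have F_lin : linear F.
  move=> c x y; rewrite /F (retract_linear k m r c); congr (_, (_, _)).
    by apply/ffunP => i; rewrite !ffunE orbit_form_linear.
  by apply/ffunP => i; rewrite !ffunE augm_linear; apply/rowP => j; rewrite !mxE.
pose f : {linear V -> T} := HB.pack F (GRing.isLinear.Build K V T _ F F_lin).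
exists f; split; last first.
  apply: wq_equivariant => z; rewrite symsq_e.
  congr (_, (_, _)).
  - by rewrite retract_der // [RHS]symsq_e.
  - apply/ffunP => i; rewrite !ffunE [RHS]W_e; exact: orbit_form_der.
  (* [e] acts as 0 on [W_1]; the bound [i.*2 < n] holds because [i < r <= 2 ^ k]. *)
  apply/ffunP => i; rewrite !ffunE [RHS]W_e (augm_der charK); last by have := ltn_ord i; lia.
  by apply/rowP => j; rewrite !mxE big1 // => l _; rewrite !mxE !ord1 mulr0.
apply: (@injective_bijective K V T f); last first.
  rewrite dim_sym2 card_ordered.
  have dim_Y : \dim {:sym2 'rV[K]_m} = 'C(m.+1, 2) by rewrite dim_sym2 card_ordered.
  have dimT : dim T =
      (dim (sym2 'rV[K]_m) + (#|'I_r| * (1 * 2 ^ k.+1) + #|'I_r| * (1 * 1)))%N by [].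
  rewrite [RHS]dimvf dimT -dimvf dim_Y card_ord.
  (* As [n + m = q] and [n - m = 2r], the two binomials differ by
     [(n - m)(n + m + 1) / 2 = r (q + 1)]. *)
  have bin2 a : (a.+1 * a = 2 * 'C(a.+1, 2))%N by rewrite -mul_bin_diag bin1.
  have := bin2 n; have := bin2 m; rewrite def_q; nia.
move=> x y eq_f; apply/eqP; rewrite -subr_eq0; apply/eqP.
have /(congr1 (fun t : T => t)) : f (x - y) = 0 by rewrite linearB eq_f subrr.
case=> retr0 /ffunP orb0 /ffunP augm0.
apply: (split_injective charK r_gt0 def_n def_N) => // [s lt_sr|l lt_lr].
  by have := orb0 (Ordinal lt_sr); rewrite !ffunE.
by have /rowP/(_ 0) := augm0 (Ordinal lt_lr); rewrite !ffunE !mxE.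
Qed.
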